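(* Let $f:\mathbb{R}^n\to\mathbb{R}$ be convex and differentiable with $L$-Lipschitz gradient ($L>0$), let $g:\mathbb{R}^n\to\mathbb{R}\cup\{+\infty\}$ be convex, proper and lower semi-continuous, let $F=f+g$ with $\operatorname{argmin}F\neq\emptyset$ and $F^\star=\min F$. Suppose $F$ has the KL property with parameters $\theta\in\,]0,1]$, $C>0$: $$\operatorname{dist}(0,\partial F(x))\ge\frac1C(F(x)-F^\star)^{1-\theta}\qquad\text{for all }x\in\operatorname{dom}F\setminus\operatorname{argmin}F.$$ Let $\gamma>0$, $\alpha_k\in[0,1]$, and let $(x_k),(y_k)$ be generated by the proximal gradient algorithm with alternated inertia: for every even $k$, $$y_{k+1}=\mathsf{T}_\gamma(x_k),\qquad x_{k+1}=y_{k+1}+\alpha_k(y_{k+1}-y_k),\qquad y_{k+2}=\mathsf{T}_\gamma(x_{k+1}),\qquad x_{k+2}=y_{k+2}.$$ For $k\ge1$ put $a_k=\frac{(2-\alpha_{2k}-\gamma L)\gamma}{2(1+\gamma L)^2}$, $s_k=\sum_{1\le\ell\le k}\min(a_\ell,2C^2)$, $C'=\liminf_k s_k/k^{1-d}$, $C''=\liminf_k s_k/\log(k)$. Then in each of the following three regimes $F(y_{2k})$ converges to $F^\star$, and $F(y_{2k})-F^\star$ satisfies: (a) if $\gamma<1/L$ (and any $\alpha_k\in[0,1]$), or if $\gamma=1/L$ and $\alpha_k\le\alpha<1$ for all $k$ (in both cases let $a>0$ be such that $a_k\ge a$ for all $k$): $\mathcal{O}\left(k^{-\left(1+\frac{2\theta}{1-2\theta}\right)}\right)$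 for $\theta\in\,]0,0.5[$; $\;\mathcal{O}\left(\left[\frac{C^2}{C^2+a}\right]^k\right)$ for $\theta\in[0.5,1[$; finite convergence for $\theta=1$; (b) if $\gamma=1/L$ and $(\alpha_k)$ converges to $1$ at rate $1/k^d$ with $d\in\,]0,1[$: $\mathcal{O}\left(k^{-\left(1+\frac{2\theta-d}{1-2\theta}\right)}\right)$ for $\theta\in\,]0,0.5[$; $\;\mathcal{O}\left(\exp\left(-\frac{C'}{2C^2}k^{1-d}\right)\right)$ for $\theta\in[0.5,1[$; finite convergence for $\theta=1$; (c) if $\gamma=1/L$ and $(\alpha_k)$ converges to $1$ at rate $1/k$: $\mathcal{O}\left(\log(k)^{-\frac{1}{1-2\theta}}\right)$ for $\theta\in\,]0,0.5[$; $\;\mathcal{O}\left(k^{-\frac{C''}{2C^2}}\right)$ for $\theta\in[0.5,1[$; finite convergence for $\theta=1$.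
   Context: $\|\cdot\|$ is the Euclidean norm. $\mathbf{prox}_h(x)=\operatorname{argmin}_w\left(h(w)+\frac12\|w-x\|^2\right)$ and $\mathsf{T}_\gamma(x)=\mathbf{prox}_{\gamma g}(x-\gamma\nabla f(x))$. $\partial F$ is the convex subdifferential, $\operatorname{dist}(0,S)=\inf_{s\in S}\|s\|$ (with $\operatorname{dist}(0,\emptyset)=+\infty$). The algorithm starts from an arbitrary $x_0$ (and $y_0$). ''$(\alpha_k)$ converges to $1$ at rate $1/k^d$'' means that there are constants $0<c_1\le c_2$ with $c_1/k^d\le 1-\alpha_k\le c_2/k^d$ for all large $k$ (and $d=1$ for rate $1/k$). ''Finite convergence'' means $F(y_{2k})=F^\star$ for all sufficiently large $k$. *)

(* Defs.v *)
From mathcomp Require Import all_boot all_order all_algebra.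
From mathcomp Require Import all_classical all_reals all_analysis.

Set Implicit Arguments.
Unset Strict Implicit.
Unset Printing Implicit Defensive.

Import Order.TTheory GRing.Theory Num.Theory.
Import numFieldNormedType.Exports.

Local Open Scope classical_set_scope.
Local Open Scope ring_scope.

Section Euclidean.
Context {R : realType} {n : nat}.
Implicit Types (x y v w : 'rV[R]_n) (h : 'rV[R]_n -> \bar R).

Definition dotv x y : R := \sum_i x ord0 i * y ord0 i.

(* The library norm of a row vector is the sup norm, which is why the
   Euclidean norm has its own definition. *)
Definition enorm x : R := Num.sqrt (dotv x x).

Definition gradient (f : 'rV[R]_n -> R) x : 'rV[R]_n :=
  \row_i 'D_(delta_mx ord0 i) f x.

Definition lipschitz_gradient (L : R) (f : 'rV[R]_n -> R) : Prop :=
  forall x y, enorm (gradient f x - gradient f y) <= L * enorm (x - y).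

(* For a function that never takes the value -oo, the convention 0 * +oo = 0
   of \bar R makes the cases t = 0 and t = 1 trivially true. *)
Definition econvex h : Prop :=
  forall (x y : 'rV[R]_n) (t : R), 0 <= t <= 1 ->
    (h (t *: x + (1 - t) *: y)%R <= t%:E * h x + (1 - t)%:E * h y)%E.

Definition eproper h : Prop :=
  (forall x, h x != -oo%E) /\ (exists x, h x != +oo%E).

Definition argmin h : set 'rV[R]_n := [set x | forall y, (h x <= h y)%E].

Definition einf h : \bar R := ereal_inf (range h).

Definition edom h : set 'rV[R]_n := [set x | (h x < +oo)%E].

Definition subdiff h x : set 'rV[R]_n :=
  [set v | h x \is a fin_num /\
           forall y, (h x + (dotv v (y - x))%:E <= h y)%E].

(* dist(0, S), equal to +oo when S is empty. *)
Definition dist0 (S : set 'rV[R]_n) : \bar R :=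
  ereal_inf [set (enorm s)%:E | s in S].

(* For h convex, proper and lower semicontinuous the argmin is a singleton and
   [xget] selects its element; the default value x is then irrelevant. *)
Definition prox h x : 'rV[R]_n :=
  xget x (argmin (fun w => h w + (2^-1 * enorm (w - x) ^+ 2)%:E)%E).

Definition KL (F : 'rV[R]_n -> \bar R) (theta C : R) : Prop :=
  forall x, (edom F `\` argmin F) x ->
    ((C^-1)%:E * (F x - einf F) `^ (1 - theta) <= dist0 (subdiff F x))%E.

Definition objective (f : 'rV[R]_n -> R) (g : 'rV[R]_n -> \bar R) :
  'rV[R]_n -> \bar R := fun x => ((f x)%:E + g x)%E.

Definition prox_grad (gamma : R) (f : 'rV[R]_n -> R) (g : 'rV[R]_n -> \bar R)
    x : 'rV[R]_n :=
  prox (fun w => gamma%:E * g w)%E (x - gamma *: gradient f x).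

Definition alternated_inertia (gamma : R) (f : 'rV[R]_n -> R)
    (g : 'rV[R]_n -> \bar R) (alpha : nat -> R) (x y : nat -> 'rV[R]_n) : Prop :=
  forall k, ~~ odd k ->
    [/\ y k.+1 = prox_grad gamma f g (x k),
        x k.+1 = y k.+1 + alpha k *: (y k.+1 - y k),
        y k.+2 = prox_grad gamma f g (x k.+1)
      & x k.+2 = y k.+2].

End Euclidean.

Section Rates.
Context {R : realType}.

Definition tends_to_1_at_rate (alpha : nat -> R) (d : R) : Prop :=
  exists c1 c2 : R, 0 < c1 <= c2 /\
    \forall k \near \oo,
      c1 / k%:R `^ d <= 1 - alpha k <= c2 / k%:R `^ d.

Definition decrease (gamma L : R) (alpha : nat -> R) (k : nat) : R :=
  (2 - alpha (2 * k)%N - gamma * L) * gamma / (2 * (1 + gamma * L) ^+ 2).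

Definition decrease_sum (gamma L C : R) (alpha : nat -> R) (k : nat) : R :=
  \sum_(1 <= l < k.+1) Num.min (decrease gamma L alpha l) (2 * C ^+ 2).

(* The subsequence of even indices; [fine] only matters for those k with
   F (y (2 * k)) = +oo. *)
Definition even_gap {n : nat} (F : 'rV[R]_n -> \bar R) (y : nat -> 'rV[R]_n)
  (k : nat) : R^o := fine (F (y (2 * k)%N) - einf F)%E.

End Rates.

(* Main.v *)
Require Import Defs.
From mathcomp Require Import all_boot all_order all_algebra.
From mathcomp Require Import all_classical all_reals all_analysis.
From mathcomp Require Import ring lra.

Set Implicit Arguments.
Unset Strict Implicit.
Unset Printing Implicit Defensive.

Import Order.TTheory GRing.Theory Num.Theory.
Import numFieldNormedType.Exports.

Local Open Scope classical_set_scope.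
Local Open Scope ring_scope.

(** Write [r k] for the gap [F (y (2 k)) - F*] and [theta] for the KL exponent.
    The proof separates the geometry, which produces one scalar recursion for
    [r], from the asymptotic analysis of that recursion.

    Geometry. The objective may increase in an extrapolated step, so only pairs
    of steps are compared. Adding the three-point inequality of the two steps of
    a pair ([prox_grad_le]) leaves a single cross term, the inner product of the
    two residuals weighted by the inertia; bounding it by the mean of the squares
    shows that [F] decreases over the pair by at least
    [(2 - alpha - gamma L) / (2 gamma)] times the squared residual of the second
    step ([two_steps_decrease]). That residual, up to the factor
    [1 / gamma + L], bounds the norm of a subgradient of [F] at the new even
    iterate ([dist0_prox_grad]), so the KL inequality there gives
    [r (k + 1) + a k / C^2 * r (k + 1) ^ (2 (1 - theta)) <= r k]
    ([even_gap_KL]). The prox is well defined because a minimizer of [F] provides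
    a subgradient of [g], hence an affine minorant.

    Asymptotics. In each regime the sums of the steps [a k] diverge, so the gap
    tends to [0]; for [theta = 1] a positive gap decreases by at least
    [a k / C^2] and thus vanishes after finitely many steps. For [theta < 1 / 2]
    the potential [r ^ (- (1 - 2 theta))] grows at least proportionally to the
    sums ([gap_potential]). For [theta >= 1 / 2] the recursion is eventually
    linear, [r (k + 1) (1 + a k / C^2) <= r k], since the gap is then at most [1].
    With constant lower bound [a] this is the geometric rate; when [a k] tends to
    [0], [1 + t >= exp (3 t / 4)] for small [t] gives the bound
    [exp (- 3 s_k / (4 C^2))], better than the claimed one by a factor in the
    exponent. This margin is what allows [s_k] to be replaced by its limit
    inferior times [k ^ (1 - d)] or [ln k] ([rate_exp]). *)

(** * Euclidean geometry and smooth convex functions *)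

Section EuclideanSpace.
Context {R : realType} {n : nat}.
Implicit Types (x y z v w : 'rV[R]_n).

Lemma dotvC x y : dotv x y = dotv y x.
Proof. by apply: eq_bigr => i _; rewrite mulrC. Qed.

Lemma dotvDl x y z : dotv (x + y) z = dotv x z + dotv y z.
Proof. by rewrite -big_split; apply: eq_bigr => i _; rewrite mxE mulrDl. Qed.

Lemma dotvZl (t : R) x y : dotv (t *: x) y = t * dotv x y.
Proof. by rewrite mulr_sumr; apply: eq_bigr => i _; rewrite mxE mulrA. Qed.

Lemma dotvNl x y : dotv (- x) y = - dotv x y.
Proof. by rewrite -scaleN1r dotvZl mulN1r. Qed.

Lemma dotvDr x y z : dotv x (y + z) = dotv x y + dotv x z.
Proof. by rewrite dotvC dotvDl !(dotvC x). Qed.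

Lemma dotvZr (t : R) x y : dotv x (t *: y) = t * dotv x y.
Proof. by rewrite dotvC dotvZl dotvC. Qed.

Lemma dotvNr x y : dotv x (- y) = - dotv x y.
Proof. by rewrite dotvC dotvNl dotvC. Qed.

Definition dotvE := (dotvDl, dotvDr, dotvNl, dotvNr, dotvZl, dotvZr).

Lemma dotv_ge0 x : 0 <= dotv x x.
Proof. by apply: sumr_ge0 => i _; rewrite -expr2 sqr_ge0. Qed.

Lemma enorm_ge0 x : 0 <= enorm x.
Proof. exact: sqrtr_ge0. Qed.

Lemma enorm_sqr x : enorm x ^+ 2 = dotv x x.
Proof. by rewrite sqr_sqrtr// dotv_ge0. Qed.

Lemma enormN x : enorm (- x) = enorm x.
Proof. by rewrite /enorm dotvNl dotvNr opprK. Qed.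

Lemma enormZ (t : R) x : 0 <= t -> enorm (t *: x) = t * enorm x.
Proof.
move=> t0; rewrite /enorm dotvZl dotvZr mulrA -expr2 sqrtrM ?sqr_ge0//.
by rewrite sqrtr_sqr ger0_norm.
Qed.

Lemma coord_le_enorm x i : `|x ord0 i| <= enorm x.
Proof.
rewrite -sqrtr_sqr ler_wsqrtr// /dotv (bigD1 i)//= -expr2 lerDl.
by apply: sumr_ge0 => j _; rewrite -expr2 sqr_ge0.
Qed.

Lemma enorm0_dotv x y : enorm x = 0 -> dotv x y = 0.
Proof.
move=> x0; apply: big1 => i _; have := coord_le_enorm x i.
by rewrite x0 normr_le0 => /eqP->; rewrite mul0r.
Qed.

(** Cauchy-Schwarz: the square norm of [(enorm y) x - (enorm x) y] is
    nonnegative and equals [2 |x| |y| (|x| |y| - <x, y>)]. *)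
Lemma dotv_le x y : dotv x y <= enorm x * enorm y.
Proof.
have := dotv_ge0 (enorm y *: x - enorm x *: y); rewrite !dotvE -!enorm_sqr.
rewrite (dotvC y x); have := enorm_ge0 x; have := enorm_ge0 y.
set a := enorm x; set b := enorm y; set c := dotv x y => b0 a0 h.
have [ab0|ab0] := ltP 0 (a * b).
  rewrite -(ler_pM2l ab0); lra.
have {h}: a * b = 0 by apply/eqP; rewrite eq_le ab0 mulr_ge0.
move=> ab; rewrite ab; move/eqP: ab.
rewrite mulf_eq0 /c => /orP[/eqP/enorm0_dotv->//|/eqP/enorm0_dotv yx].
by rewrite dotvC yx.
Qed.

Lemma enorm_triangle x y : enorm (x + y) <= enorm x + enorm y.
Proof.
rewrite -ler_sqr ?nnegrE ?addr_ge0 ?enorm_ge0// enorm_sqr !dotvE (dotvC y x).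
by rewrite -!enorm_sqr; have := dotv_le x y; lra.
Qed.

Lemma norm_le_enorm x : `|x| <= enorm x.
Proof.
rewrite [leLHS]/Num.norm/= mx_normrE; apply: bigmax_le; first exact: enorm_ge0.
by move=> [i j] _ /=; rewrite ord1 coord_le_enorm.
Qed.

Lemma continuous_enorm_sqr (p : 'rV[R]_n) :
  continuous (fun w => 2^-1 * enorm (w - p) ^+ 2).
Proof.
have -> : (fun w => 2^-1 * enorm (w - p) ^+ 2) =
   (fun w => 2^-1 * \sum_i (w ord0 i - p ord0 i) * (w ord0 i - p ord0 i)).
  apply/funext => w; rewrite enorm_sqr; congr (_ * _).
  by apply: eq_bigr => i _; rewrite !mxE.
have cts : continuous (fun w : 'rV[R]_n =>
    \sum_i (w ord0 i - p ord0 i) * (w ord0 i - p ord0 i) : R^o).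
  apply: (continuous_big (@add_continuous R^o)) => i _ w.
  have h := cvgB (@coord_continuous R 1 n ord0 i w) (cvg_cst (p ord0 i)).
  exact: (cvgM (h _ _) (h _ _)).
by move=> w; apply: (cvgM (cvg_cst (2^-1 : R)) (cts w)).
Qed.

End EuclideanSpace.

Section SmoothConvex.
Context {R : realType} {n : nat}.
Variable f : 'rV[R]_n -> R.
Hypothesis f_diff : forall z, differentiable f z.
Implicit Types (x y z v w h : 'rV[R]_n).

Lemma derive_gradient x v : 'D_v f x = dotv (gradient f x) v.
Proof.
rewrite deriveE// {1}(row_sum_delta v) linear_sum/=; apply: eq_bigr => i _.
by rewrite linearZ/= mxE deriveE// mulrC.
Qed.

Lemma is_derive_line x h (t : R) :
  is_derive t 1 (fun s : R => f (x + s *: h)) (dotv (gradient f (x + t *: h)) h).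
Proof.
rewrite -derive_gradient.
have lim : (fun s : R => s^-1 *: (f (s *: h + (x + t *: h)) - f (x + t *: h)))
    @ 0^' --> 'D_h f (x + t *: h) by exact: diff_derivable.
have eq_quot : (fun s : R => s^-1 *: (f (x + (s *: 1 + t) *: h) - f (x + t *: h)))
    = (fun s : R => s^-1 *: (f (s *: h + (x + t *: h)) - f (x + t *: h))).
  by apply/funext => s /=; rewrite scalerDl addrCA -[s *: 1]/(s * 1) mulr1.
apply: DeriveDef; last by rewrite /derive eq_quot; exact: cvg_lim.
by rewrite /derivable eq_quot; apply/cvg_ex; exists ('D_h f (x + t *: h)).
Qed.

(** Along the segment from [x] to [x + h], the difference of [f] and its
    quadratic model has a nonpositive derivative, by the Lipschitz condition and
    Cauchy-Schwarz. *)
Lemma descent (L : R) (f_smooth : lipschitz_gradient L f) x h :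
  f (x + h) <= f x + dotv (gradient f x) h + L / 2 * enorm h ^+ 2.
Proof.
pose psi (t : R) := f (x + t *: h) - (t * dotv (gradient f x) h +
  t ^+ 2 * (L / 2 * enorm h ^+ 2)).
pose dpsi (t : R) := dotv (gradient f (x + t *: h)) h -
  (dotv (gradient f x) h + t * (L * enorm h ^+ 2)).
have dp (t : R) : is_derive t 1 psi (dpsi t).
  have := is_derive_line x h t => dl.
  rewrite /psi; apply: is_derive_eq.
  by rewrite /dpsi /GRing.scale/=; field.
have dpsi_le0 t : 0 <= t -> dpsi t <= 0.
  move=> t0; have := dotv_le (gradient f (x + t *: h) - gradient f x) h.
  have := f_smooth (x + t *: h) x; rewrite [x + _ - x]addrC addKr enormZ//.
  rewrite dotvDl dotvNl /dpsi => h1 h2.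
  suff : enorm (gradient f (x + t *: h) - gradient f x) * enorm h <=
    t * (L * enorm h ^+ 2) by lra.
  apply: (le_trans (ler_wpM2r (enorm_ge0 h) h1)).
  by rewrite expr2 le_eqVlt; apply/orP; left; apply/eqP; ring.
have : psi 1 <= psi 0.
  apply: (@ler0_derive1_le_cc _ psi 0 1); rewrite ?in_itv/= ?lexx ?ler01//.
  - move=> t; rewrite in_itv/= => /andP[t0 _].
    by rewrite derive1E (@derive_val _ _ _ _ _ _ _ (dp t)) dpsi_le0// ltW.
  - by apply: derivable_within_continuous => t _; have [] := dp t.
rewrite /psi !scale0r !scale1r addr0; lra.
Qed.

(** The difference quotients of [f] at [x] towards [z] are at most [f z - f x]
    by convexity; the gradient inequality is their limit from the right. *)
Lemma convex_gradient (f_convex : @convex_function R 'rV[R]_n setT f) x z :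
  f x + dotv (gradient f x) (z - x) <= f z.
Proof.
suff : dotv (gradient f x) (z - x) <= f z - f x by lra.
rewrite -derive_gradient.
have cv : cvg ((fun s : R => s^-1 *: (f (s *: (z - x) + x) - f x)) @ 0^').
  exact: diff_derivable.
have cvr : (fun s : R => s^-1 *: (f (s *: (z - x) + x) - f x)) @ 0^'+ -->
    'D_(z - x) f x.
  move=> A /cv /nbhs_ballP[e /= e0 eA]; exists e => // s es s0.
  by apply: eA => //; rewrite gt_eqF.
apply: (@cvgr_to_le _ _ _ _ _ _ _ cvr).
near=> s.
have s0 : 0 < s by [].
have s1 : s <= 1 by near: s; exact: nbhs_right_ltW.
rewrite -[_ *: _]/(_ * _) ler_pdivrMl//.
have := f_convex (Itv01 (ltW s0) s1) z x.
rewrite !inE => /(_ I I); rewrite !convRE.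
rewrite -[X in f X]/(s *: z + (1 - s) *: x).
have -> : s *: z + (1 - s) *: x = s *: (z - x) + x.
  by rewrite scalerBr scalerBl scale1r addrA addrAC.
rewrite -[X in _ <= X]/(s * f z + (1 - s) * f x); lra.
Unshelve. all: by end_near.
Qed.

End SmoothConvex.

(** * Existence and optimality of the proximal point *)

Section ConvexMinimization.
Context {R : realType} {n : nat}.
Implicit Types (x y z v w p : 'rV[R]_n) (h : 'rV[R]_n -> \bar R).

Lemma ge0_of_affine_ge0 (A B : R) :
  (forall t : R, 0 < t <= 1 -> 0 <= A + t * B) -> 0 <= A.
Proof.
move=> AB; rewrite leNgt; apply/negP => A0.
have := AB 1; rewrite mul1r ltr01 lexx => /(_ isT) AB1.
have B0 : 0 < B by lra.
have /AB : 0 < - A / (2 * B) <= 1.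
  rewrite divr_gt0 ?oppr_gt0 ?mulr_gt0//= ler_pdivrMr ?mulr_gt0//; lra.
have -> : - A / (2 * B) * B = - A / 2 by field; rewrite gt_eqF.
lra.
Qed.

(** Fermat's rule without a sum rule for subdifferentials: moving from [z]
    towards [w] by a fraction [t] changes [h] by at most [t (h w - h z)] and
    [q] by at most [t <v, w - z> + O(t^2)]; minimality makes the sum of the two
    nonnegative, and [t] tends to 0. *)
Lemma minimizer_subgradient h (q : 'rV[R]_n -> R) z v (M : R) :
  econvex h -> (forall w, h w != -oo%E) -> h z \is a fin_num ->
  (forall w, (h z + (q z)%:E <= h w + (q w)%:E)%E) ->
  (forall w, q w <= q z + dotv v (w - z) + M * enorm (w - z) ^+ 2) ->
  subdiff h z (- v).
Proof.
move=> hcvx hNy hz zmin qle; split => // w.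
move: (hz) => /fineK hzE; set c := fine (h z) in hzE.
case hw: (h w) => [b||]; last 2 first.
- by rewrite leey.
- by move: (hNy w); rewrite hw eqxx.
rewrite -hzE -EFinD lee_fin dotvNl.
suff : 0 <= b - c + dotv v (w - z) by lra.
apply: (@ge0_of_affine_ge0 _ (M * enorm (w - z) ^+ 2)) => t /andP[t0 t1].
pose wt := t *: w + (1 - t) *: z.
have wtE : wt - z = t *: (w - z).
  by rewrite /wt scalerBl scale1r -addrA addrAC subrr add0r scalerBr.
have hwt : (h wt <= (t * b + (1 - t) * c)%:E)%E.
  by have := hcvx w z t; rewrite ltW// t1 => /(_ isT); rewrite hw -hzE -!EFinM -EFinD.
have qwt : q wt <= q z + t * dotv v (w - z) + t ^+ 2 * (M * enorm (w - z) ^+ 2).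
  by have := qle wt; rewrite wtE dotvZr enormZ ?(ltW t0)// exprMn; lra.
have : ((c + q z)%:E <= (t * b + (1 - t) * c + q wt)%:E)%E.
  by rewrite !EFinD hzE (le_trans (zmin wt))// leeD2r.
rewrite lee_fin -(pmulr_rge0 _ t0) => le1; lra.
Qed.

Lemma lsc_add_continuous h (q : 'rV[R]_n -> R) :
  lower_semicontinuous h -> continuous q ->
  lower_semicontinuous (fun w => h w + (q w)%:E)%E.
Proof.
move=> hlsc qc x a axh.
have [b ab bh] : exists2 b : R, a - b < q x & (b%:E < h x)%E.
  move: axh; case: (h x) => [r||] //=.
    rewrite -EFinD lte_fin => arq; exists ((a - q x + r) / 2); first by lra.
    by rewrite lte_fin; lra.
  by move=> _; exists (a - q x + 1); [lra | rewrite ltry].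
have [V Vx Vb] := hlsc x b bh.
exists (V `&` [set w | a - b < q w]).
  by apply: filterI => //; exact: (cvgr_gt (q x) (qc x)).
move=> w [/Vb bw /= abq]; apply: (@lt_le_trans _ _ (b + q w)%:E).
  by rewrite lte_fin; lra.
by rewrite EFinD leeD2r// ltW.
Qed.

Lemma lsc_pscale (c : R) h : 0 < c ->
  lower_semicontinuous h -> lower_semicontinuous (fun w => c%:E * h w)%E.
Proof.
move=> c0 hlsc x a.
rewrite muleC -lte_pdivrMr// -EFinM => /(hlsc x)[V Vx Vb].
by exists V => // w /Vb; rewrite EFinM lte_pdivrMr// muleC.
Qed.

(** The sublevel sets of [h] are totally ordered by inclusion, hence generate a
    filter; it contains a compact set, and by lower semicontinuity each of its
    cluster points lies in all sublevel sets. *)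
Lemma lsc_argmin_neq0 h z (B : R) :
  lower_semicontinuous h ->
  (forall w, (h w <= h z)%E -> enorm w <= B) ->
  argmin h !=set0.
Proof.
move=> hlsc bnd.
pose sub w := [set y | (h y <= h w)%E].
pose F := filter_from [set w | (h w <= h z)%E] sub.
have FF : ProperFilter F.
  apply: filter_from_proper; last by move=> w _; exists w; rewrite /sub /=.
  apply: filter_from_filter; first by exists z => /=.
  move=> u w /= hu hw; have [uw|/ltW wu] := leP (h u) (h w).
    by exists u => // y yu; split => //; exact: le_trans yu uw.
  by exists w => // y yw; split => //; exact: le_trans yw wu.
pose K := [set w : 'rV[R]_n | `|w| <= B].
have cK : compact K.
  apply: bounded_closed_compact.
    by exists B; split; [exact: num_real | move=> M BM w /le_trans; apply; exact: ltW].
  have -> : K = (fun w => `|w|) @^-1` [set t | t <= B] by [].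
  by apply: closed_comp; [move=> w _; exact: norm_continuous | exact: closed_le].
have [|p [_ Fp]] := cK F FF.
  exists z => //= w; rewrite /sub /K /= => /bnd.
  exact: le_trans (norm_le_enorm _).
have pmin w : (h w <= h z)%E -> (h p <= h w)%E.
  move=> wz; rewrite leNgt; apply/negP => wp.
  have [a wa ap] : exists2 a : R, (h w <= a%:E)%E & (a%:E < h p)%E.
    move: wp; case: (h w) => [r||]; [by exists r | by case: (h p) |].
    case: (h p) => [r _||] //; last by move=> _; exists 0; rewrite ?leNye ?ltry.
    by exists (r - 1); rewrite ?leNye// lte_fin; lra.
  have [V Vp Va] := hlsc p a ap.
  have [u [uw /Va]] : sub w `&` V !=set0 by apply: Fp => //; exists w.
  by rewrite ltNge (le_trans uw wa).
exists p => w; have [/pmin//|/ltW zw] := leP (h w) (h z).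
exact: le_trans (pmin z (lexx _)) zw.
Qed.

End ConvexMinimization.

Section ProximalMap.
Context {R : realType} {n : nat}.
Implicit Types (x y z v w p : 'rV[R]_n) (h : 'rV[R]_n -> \bar R).

(** One subgradient of [h] gives an affine minorant of [h], which makes the
    prox objective coercive, hence its argmin nonempty. *)
Lemma prox_argmin h p z v : lower_semicontinuous h -> subdiff h z v ->
  argmin (fun w => h w + (2^-1 * enorm (w - p) ^+ 2)%:E)%E (prox h p).
Proof.
move=> hlsc [hz zv]; rewrite /prox; case: xgetP => [y _ //|nomin].
set H := (fun w => _) in nomin *.
suff [y ymin] : argmin H !=set0 by case: (nomin y).
pose A := 2 * (enorm (p - z) * enorm v) + enorm (z - p) ^+ 2.
(* With [W = enorm (w - p)], a point [w] of the sublevel set of [z] satisfies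
   [W ^ 2 <= 2 |v| W + A], hence [W <= 1 + A + 2 |v|]. *)
apply: (@lsc_argmin_neq0 _ _ _ z (1 + A + 2 * enorm v + enorm p)).
  exact: lsc_add_continuous (@continuous_enorm_sqr _ _ p).
move=> w; rewrite /H => Hwz.
have := le_trans (leeD2r _ (zv w)) Hwz.
rewrite -(fineK hz) -!EFinD lee_fin.
have -> : w - z = (w - p) + (p - z) by rewrite addrA subrK.
rewrite dotvDr => Hle.
have := dotv_le (- v) (w - p); have := dotv_le (- v) (p - z).
rewrite !dotvNl !enormN => le1 le2.
have := enorm_triangle (w - p) p; rewrite subrK.
have := enorm_ge0 (w - p); have := enorm_ge0 v.
move: le1 le2 Hle; rewrite /A; set W := enorm (w - p).
set V := enorm v; set P := enorm (p - z) * V.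
have -> : V * enorm (p - z) = P by rewrite mulrC.
set Z := enorm (z - p).
move=> le1 le2 Hle V0 W0 tri.
apply: (le_trans tri); rewrite lerD2r.
have : W ^+ 2 <= 2 * V * W + 2 * P + Z ^+ 2 by lra.
have : 0 <= P by rewrite mulr_ge0 ?enorm_ge0.
have : 0 <= Z ^+ 2 by rewrite sqr_ge0.
nra.
Qed.

(** The prox objective being [h] plus a smooth quadratic, Fermat's rule turns
    minimality of [prox h p] into the inclusion [p - prox h p] in the
    subdifferential. *)
Lemma prox_subgradient h p z v :
  econvex h -> (forall w, h w != -oo%E) -> lower_semicontinuous h ->
  subdiff h z v -> subdiff h (prox h p) (p - prox h p).
Proof.
move=> hcvx hNy hlsc zv; have pmin := prox_argmin p hlsc zv.
set u := prox h p in pmin *.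
have hu : h u \is a fin_num.
  rewrite fin_numE hNy/=; apply: contraTneq isT => hu; have := pmin z.
  by case: zv => hz _; rewrite hu addye// leye_eq -(fineK hz).
rewrite -(opprB u p); apply: (minimizer_subgradient (M := 2^-1) hcvx hNy hu pmin).
move=> w; have -> : w - p = (w - u) + (u - p) by rewrite addrA subrK.
rewrite !enorm_sqr; move: (w - u) (u - p) => a b.
by rewrite !dotvE (dotvC a b); lra.
Qed.

End ProximalMap.

(** * The proximal gradient step *)

Section PositiveScaling.
Context {R : realType} {n : nat}.
Variables (c : R) (h : 'rV[R]_n -> \bar R).
Hypothesis c_gt0 : 0 < c.

Let c_gt0E : (0 < c%:E)%E. Proof. by rewrite lte_fin. Qed.

Lemma subdiff_pscale z v :
  subdiff (fun w => c%:E * h w)%E z (c *: v) <-> subdiff h z v.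
Proof.
have fin : ((c%:E * h z)%E \is a fin_num) = (h z \is a fin_num).
  by case: (h z) => [r||]; [rewrite -EFinM|rewrite gt0_muley|rewrite gt0_muleNy].
rewrite /subdiff /= fin; split=> -[hz hv]; split => // w; have := hv w;
  by rewrite -(fineK hz) dotvZl -EFinM -!EFinD -mulrDr EFinM lee_pmul2l.
Qed.

Lemma econvex_pscale : (forall w, h w != -oo%E) -> econvex h ->
  econvex (fun w => c%:E * h w)%E.
Proof.
move=> hNy hcvx a b t t01; have t0 : 0 <= t by case/andP: t01.
have t1 : 0 <= 1 - t by case/andP: t01 => _ ?; rewrite subr_ge0.
have NyM u s : 0 <= s -> (s%:E * h u)%E != -oo%E.
  rewrite le_eqVlt => /predU1P[<-|s0]; first by rewrite mul0e.
  by move: (hNy u); case: (h u) => [r||] //; rewrite gt0_muley ?lte_fin.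
rewrite !(muleCA _ c%:E) -muleDr ?lee_pmul2l ?hcvx//.
by rewrite /adde_def !negb_and (NyM a t t0) (NyM b _ t1) !orbT.
Qed.

End PositiveScaling.

Section ProximalGradient.
Context {R : realType} {n : nat}.
Variables (f : 'rV[R]_n -> R) (g : 'rV[R]_n -> \bar R) (L gamma : R).
Hypothesis f_convex : @convex_function R 'rV[R]_n setT f.
Hypothesis f_diff : forall z, differentiable f z.
Hypothesis f_smooth : lipschitz_gradient L f.
Hypothesis g_convex : econvex g.
Hypothesis g_proper : eproper g.
Hypothesis g_lsc : lower_semicontinuous g.
Hypothesis F_argmin : argmin (objective f g) !=set0.
Hypothesis gamma_gt0 : 0 < gamma.
Implicit Types (x y z v w h : 'rV[R]_n).

Notation F := (objective f g).
Notation T := (prox_grad gamma f g).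

Lemma objective_neqNy w : F w != -oo%E.
Proof. by rewrite /objective; have := g_proper.1 w; case: (g w). Qed.

Lemma objective_fin_num w : (F w \is a fin_num) = (g w \is a fin_num).
Proof. by rewrite /objective fin_numD. Qed.

Lemma argmin_fin_num z : argmin F z -> F z \is a fin_num.
Proof.
move=> zmin; rewrite fin_numE objective_neqNy/=.
have [w gw] := g_proper.2; apply: contraNN gw => /eqP Fz.
by have := zmin w; rewrite Fz /objective leye_eq => /eqP; case: (g w).
Qed.

Lemma einf_argmin z : argmin F z -> einf F = F z.
Proof.
move=> zmin; apply/eqP; rewrite eq_le; apply/andP; split.
  by apply: ereal_inf_lbound; exists z.
by apply: le_ereal_inf_tmp => _ [w _ <-]; exact: zmin.
Qed.

Lemma einf_fin_num : einf F \is a fin_num.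
Proof. by have [z zmin] := F_argmin; rewrite (einf_argmin zmin) argmin_fin_num. Qed.

Lemma einf_le w : (einf F <= F w)%E.
Proof. by apply: ereal_inf_lbound; exists w. Qed.

(** At a minimizer of [F], Fermat's rule with smooth part [f] gives a
    subgradient of [g]; this makes the prox of [g] well defined. *)
Lemma argmin_subgradient z : argmin F z -> subdiff g z (- gradient f z).
Proof.
move=> zmin; apply: (@minimizer_subgradient _ _ g f z _ (L / 2)) => //.
- exact: g_proper.1.
- by rewrite -objective_fin_num argmin_fin_num.
- by move=> w; have := zmin w; rewrite /objective ![((f _)%:E + _)%E]addeC.
- by move=> w; have := descent f_diff f_smooth z (w - z); rewrite addrC subrK.
Qed.

Lemma prox_grad_subgradient x :
  subdiff g (T x) (gamma^-1 *: (x - T x) - gradient f x).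
Proof.
have [z zmin] := F_argmin; have [gz zv] := argmin_subgradient zmin.
have gNy := g_proper.1.
have Ny w : (gamma%:E * g w)%E != -oo%E.
  by move: (gNy w); case: (g w) => [r||] //; rewrite gt0_muley ?lte_fin.
have /(subdiff_pscale g gamma_gt0) sub : subdiff g z (- gradient f z) by [].
apply/(subdiff_pscale g gamma_gt0).
have := prox_subgradient (x - gamma *: gradient f x)
  (econvex_pscale gamma_gt0 gNy g_convex) Ny (lsc_pscale gamma_gt0 g_lsc) sub.
rewrite -/(T x) scalerBr scalerA divff ?gt_eqF// scale1r.
by rewrite [x - T x - _]addrAC.
Qed.

Lemma prox_grad_fin_num x : F (T x) \is a fin_num.
Proof. by rewrite objective_fin_num; case: (prox_grad_subgradient x). Qed.

(** Optimality of the prox step puts [(x - T x) / gamma - grad f x] in the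
    subdifferential of [g] at [T x]; adding [grad f (T x)] gives a subgradient of
    [F], small when the step is short. *)
Lemma prox_grad_residual x :
  subdiff F (T x) (gamma^-1 *: (x - T x) - gradient f x + gradient f (T x)).
Proof.
have [gT Tsub] := prox_grad_subgradient x.
split; first exact: prox_grad_fin_num.
move=> w; rewrite dotvDl; move: (Tsub w).
have := convex_gradient f_diff f_convex (T x) w.
rewrite /objective -(fineK gT) => cf.
case: (g w) => [r||].
- by rewrite -!EFinD !lee_fin; lra.
- by move=> _; rewrite addey// leey.
- by rewrite leNgt -?EFinD ltNyr.
Qed.

Lemma dist0_prox_grad x :
  (dist0 (subdiff F (T x)) <= ((gamma^-1 + L) * enorm (x - T x))%:E)%E.
Proof.
set v := gamma^-1 *: (x - T x) - gradient f x + gradient f (T x).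
apply: (@le_trans _ _ (enorm v)%:E).
  by apply: ereal_inf_lbound; exists v => //; exact: prox_grad_residual.
rewrite lee_fin /v -addrA; apply: (le_trans (enorm_triangle _ _)).
rewrite enormZ ?invr_ge0 ?(ltW gamma_gt0)// mulrDl lerD2l addrC.
apply: (le_trans (f_smooth _ _)).
by rewrite -[in leRHS]enormN opprB.
Qed.

(** The three-point inequality of a proximal gradient step: the descent
    inequality for [f] from [x], the gradient inequality for [f] between [x] and
    [z], and the subgradient inequality for [g] at [T x] add up to it. Keeping the
    inner product instead of completing squares lets it be used below for both
    [z = x] and the previous iterate. *)
Lemma prox_grad_le x z : (F (T x) <= F z + (gamma^-1 * dotv (x - T x) (x - z) -
  (gamma^-1 - L / 2) * enorm (x - T x) ^+ 2)%:E)%E.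
Proof.
have [gT /(_ z)] := prox_grad_subgradient x.
have := convex_gradient f_diff f_convex x z.
have := descent f_diff f_smooth x (T x - x).
rewrite [x + _]addrC subrK /objective -(fineK gT).
set t := fine _; set u := T x.
have -> : z - u = (x - u) - (x - z) by rewrite [RHS]addrC opprB addrA subrK.
have -> : u - x = - (x - u) by rewrite opprB.
have -> : z - x = - (x - z) by rewrite opprB.
rewrite enormN enorm_sqr.
move: (x - u) (x - z) (gradient f x) => U Z G; rewrite !dotvE.
case: (g z) => [r||] h1 h2.
- by rewrite -!EFinD !lee_fin; lra.
- by move=> _; rewrite addey// addye// leey.
- by rewrite leNgt -?EFinD ltNyr.
Qed.

(** A plain step from [x] followed by a step from the point extrapolated along
    the first displacement. The three-point inequality with [z = x] and then
    [z = y] shows that the extrapolation costs only [a / gamma] times the inner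
    product of the two residuals, which is at most the mean of their squares. So
    [F] decreases over the pair of steps, although it may increase in the
    second. *)
Lemma two_steps_decrease x y x' (a : R) : 0 <= a -> a + gamma * L <= 2 ->
  y = T x -> x' = y + a *: (y - x) ->
  (F (T x') + ((2 - a - gamma * L) / (2 * gamma) * enorm (x' - T x') ^+ 2)%:E
    <= F x)%E.
Proof.
move=> a0 aL yE x'E.
have := prox_grad_le x' y; have := prox_grad_le x x.
have -> : x' - y = - (a *: (x - y)).
  by rewrite x'E addrC addKr -scalerN opprB.
rewrite subrr -yE -(fineK (prox_grad_fin_num x')).
have Fy : F y \is a fin_num by rewrite yE prox_grad_fin_num.
rewrite -(fineK Fy) dotvNr dotvZr.
have -> : dotv (x - y) 0 = 0 by rewrite -(scale0r 0) dotvZr mul0r.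
rewrite !enorm_sqr.
have := dotv_ge0 ((x' - T x') + (x - y)); have := dotv_ge0 (x - y).
have := dotv_ge0 (x' - T x').
move: (x' - T x') (x - y) => U D U0 D0; rewrite !dotvE (dotvC D U) => UD.
case: (F x) => [r||]; last 2 first.
- by move=> *; rewrite leey.
- by rewrite leNgt -?EFinD ltNyr.
rewrite -!EFinD !lee_fin => h1 h2.
have -> : (2 - a - gamma * L) / (2 * gamma) = gamma^-1 * ((2 - a - gamma * L) / 2).
  by field; rewrite gt_eqF.
have c0 : 0 <= gamma^-1 * ((2 - a - gamma * L) / 2).
  by rewrite mulr_ge0 ?invr_ge0 ?(ltW gamma_gt0)//; lra.
have LE : L / 2 = gamma^-1 * (gamma * L / 2) by field; rewrite gt_eqF.
have h3 := mulr_ge0 c0 D0.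
have : 0 <= gamma^-1 * a / 2 * (dotv U U + dotv U D + (dotv U D + dotv D D)).
  by rewrite mulr_ge0 ?divr_ge0 ?mulr_ge0 ?invr_ge0 ?(ltW gamma_gt0).
rewrite LE in h1 h2; lra.
Qed.

End ProximalGradient.

(** * The recursion satisfied by the gap *)

Section GapRecursion.
Context {R : realType} {n : nat}.
Variables (f : 'rV[R]_n -> R) (g : 'rV[R]_n -> \bar R) (L gamma theta C : R).
Variables (alpha : nat -> R) (x y : nat -> 'rV[R]_n).
Hypothesis f_convex : @convex_function R 'rV[R]_n setT f.
Hypothesis f_diff : forall z, differentiable f z.
Hypothesis f_smooth : lipschitz_gradient L f.
Hypothesis g_convex : econvex g.
Hypothesis g_proper : eproper g.
Hypothesis g_lsc : lower_semicontinuous g.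
Hypothesis F_argmin : argmin (objective f g) !=set0.
Hypothesis L_gt0 : 0 < L.
Hypothesis gamma_gt0 : 0 < gamma.
Hypothesis C_gt0 : 0 < C.
Hypothesis F_KL : KL (objective f g) theta C.
Hypothesis alpha_range : forall k, 0 <= alpha k <= 1.
Hypothesis gammaL : gamma * L <= 1.
Hypothesis algo : alternated_inertia gamma f g alpha x y.

Notation F := (objective f g).
Notation r := (even_gap F y).

Lemma even_iterates k : (0 < k)%N ->
  [/\ x (2 * k)%N = y (2 * k)%N &
      exists v, y (2 * k)%N = prox_grad gamma f g v].
Proof.
case: k => // k _; have [|_ _ yE xE] := @algo (2 * k)%N; first by rewrite mul2n odd_double.
by rewrite mulnS; split => //; exists (x (2 * k).+1).
Qed.

Lemma even_gapE k : (0 < k)%N -> F (y (2 * k)%N) = (einf F + (r k)%:E)%E.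
Proof.
move=> /even_iterates[_ [v yE]].
have Fy : F (y (2 * k)%N) \is a fin_num by rewrite yE; exact: prox_grad_fin_num.
have Fi : einf F \is a fin_num by apply: einf_fin_num.
by rewrite /even_gap fineK ?fin_numB ?Fy// addeC subeK.
Qed.

Lemma even_gap_ge0 k : 0 <= r k.
Proof. by apply: fine_ge0; rewrite sube_ge0 ?einf_fin_num ?einf_le. Qed.

Lemma decrease_ge0 k : 0 <= decrease gamma L alpha k.
Proof.
have /andP[_ a1] := alpha_range (2 * k)%N.
apply: divr_ge0; last by rewrite mulr_ge0// sqr_ge0.
by rewrite mulr_ge0 ?(ltW gamma_gt0)//; have := gammaL; lra.
Qed.

(** For [k > 0] the step at index [2 * k] starts from [y (2 * k)] itself, so a
    pair of steps compares two consecutive even iterates. *)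
Lemma even_gap_step k : (0 < k)%N ->
  r k.+1 + (2 - alpha (2 * k)%N - gamma * L) / (2 * gamma) *
    enorm (x (2 * k).+1 - y (2 * k.+1)%N) ^+ 2 <= r k.
Proof.
move=> k0; have [xyE _] := even_iterates k0.
have [|y1 x1 y2 _] := @algo (2 * k)%N; first by rewrite mul2n odd_double.
have /andP[a0 a1] := alpha_range (2 * k)%N.
have := @two_steps_decrease _ _ f g L gamma f_convex f_diff f_smooth g_convex
  g_proper g_lsc F_argmin gamma_gt0 (x (2 * k)%N) _ (x (2 * k).+1) _ a0 _ y1.
rewrite xyE -y2 => /(_ _ x1).
have -> : (2 * k).+2 = (2 * k.+1)%N by rewrite mulnS.
have Fi : einf F \is a fin_num by apply: einf_fin_num.
rewrite even_gapE// even_gapE// -(fineK Fi) -!EFinD lee_fin -addrA lerD2l.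
by apply; have := gammaL; lra.
Qed.

Lemma even_gap_nincr k : (0 < k)%N -> r k.+1 <= r k.
Proof.
move=> /even_gap_step; apply: le_trans; rewrite lerDl.
have /andP[_ a1] := alpha_range (2 * k)%N.
by rewrite mulr_ge0 ?sqr_ge0// divr_ge0 ?mulr_ge0 ?(ltW gamma_gt0)//;
  have := gammaL; lra.
Qed.

(** The residual of the second step controls the distance to the subdifferential
    at the new even iterate, up to the factor [1 / gamma + L], which the
    normalization of [decrease] absorbs; the KL inequality then turns that
    distance into a power of the new gap. *)
Lemma even_gap_KL k : (0 < k)%N -> 0 < r k.+1 ->
  decrease gamma L alpha k / C ^+ 2 * r k.+1 `^ (2 * (1 - theta)) <=
    r k - r k.+1.
Proof.
move=> k0 rk0; rewrite lerBrDl; apply: le_trans (even_gap_step k0); rewrite lerD2l.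
have [|_ _ y2 _] := @algo (2 * k)%N; first by rewrite mul2n odd_double.
set u := y (2 * k.+1)%N; have uE : u = prox_grad gamma f g (x (2 * k).+1).
  by rewrite /u mulnS.
have Fu := even_gapE (ltn0Sn k); rewrite -/u in Fu.
have Fi : einf F \is a fin_num by apply: einf_fin_num.
have : (edom F `\` argmin F) u.
  split.
    by rewrite /edom/= Fu -(fineK Fi) -EFinD ltry.
  by move=> /einf_argmin; rewrite Fu -(fineK Fi) -EFinD => -[]; lra.
move=> /F_KL; rewrite Fu addeAC subee// add0e poweR_EFin -EFinM => kl.
have := le_trans kl (eq_ind_r (fun w => (dist0 (subdiff F w) <= _)%E)
  (dist0_prox_grad f_convex f_diff f_smooth g_convex g_proper g_lsc F_argmin
    gamma_gt0 (x (2 * k).+1)) uE).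
rewrite -uE lee_fin => {}kl.
have /andP[_ a1] := alpha_range (2 * k)%N.
have -> : r k.+1 `^ (2 * (1 - theta)) = (r k.+1 `^ (1 - theta)) ^+ 2.
  by rewrite mulrC powRrM -powR_mulrn ?powR_ge0.
set e := enorm _ in kl *; set p := r k.+1 `^ _ in kl *.
have {}kl : (C^-1 * p) ^+ 2 <= ((gamma^-1 + L) * e) ^+ 2.
  by rewrite ler_sqr ?nnegrE// mulr_ge0 ?enorm_ge0 ?powR_ge0 ?addr_ge0 ?invr_ge0 ?ltW.
apply: (@le_trans _ _ (decrease gamma L alpha k * (C^-1 * p) ^+ 2)).
  by rewrite exprMn exprVn -mulrA.
apply: (le_trans (ler_wpM2l (decrease_ge0 k) kl)).
rewrite le_eqVlt /decrease; apply/orP; left; apply/eqP; field.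
have gL : 0 < gamma * L by rewrite mulr_gt0.
rewrite !gt_eqF//=; lra.
Qed.

Lemma objective_cvg : r k @[k --> \oo] --> (0 : R) ->
  F (y (2 * k)%N) @[k --> \oo] --> einf F.
Proof.
have Fi : einf F \is a fin_num by apply: einf_fin_num.
move=> r0; rewrite -[in X in _ --> X](fineK Fi).
have : (fine (einf F) + r k)%:E @[k --> \oo] --> (fine (einf F) + 0)%:E.
  by apply: cvg_EFin; [exact: nearW | apply: cvgD => //; exact: cvg_cst].
rewrite addr0; apply: cvg_trans; apply: near_eq_cvg.
by exists 1%N => // k /= k0; rewrite EFinD fineK// even_gapE.
Qed.

Lemma objective_finite : (\forall k \near \oo, r k = 0) ->
  \forall k \near \oo, F (y (2 * k)%N) = einf F.
Proof.
move=> r0; near=> k; rewrite even_gapE; last by near: k; exists 1%N.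
by have -> : r k = 0; [near: k | rewrite adde0].
Unshelve. all: by end_near. Qed.

End GapRecursion.

(** * Scalar sequences satisfying the recursion *)

Section ScalarInequalities.
Context {R : realType}.
Implicit Types u q t : R.

Lemma powR_1D_ge u q : 0 <= u -> 0 <= q -> 1 + q * (u / (1 + u)) <= (1 + u) `^ q.
Proof.
move=> u0 q0; have u1 : 0 < 1 + u by rewrite ltr_pwDl.
rewrite /powR gt_eqF//; apply: (le_trans _ (expR_ge1Dx _)).
rewrite lerD2l ler_wpM2l// -[leRHS]opprK lerNr -lnV ?posrE//.
have uE : (1 + u)^-1 = 1 + - (u / (1 + u)) by field; rewrite gt_eqF.
rewrite [X in ln X]uE.
by apply: le_ln1Dx; rewrite ltrNr opprK ltr_pdivrMr//; lra.
Qed.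

(** Any factor strictly between [1 / 2] and [1] would serve in place of
    [3 / 4], with another bound on [t]. *)
Lemma expR_le_1D t : 0 <= t <= 3^-1 -> expR (3 / 4 * t) <= 1 + t.
Proof.
move=> /andP[t0 t1]; rewrite -[leLHS]invrK -expRN invf_ple ?posrE ?expR_gt0//; last lra.
apply: le_trans (expR_ge1Dx _).
rewrite -[leLHS]mul1r ler_pdivrMr; last lra.
nra.
Qed.

End ScalarInequalities.

Section SequenceBounds.
Context {R : realType}.
Implicit Types (r e v m : nat -> R).

Lemma sum_le_telescope m v (c : R) k : (0 < k)%N ->
  (forall l, (0 < l < k)%N -> c * m l <= v l.+1 - v l) ->
  c * \sum_(1 <= l < k) m l <= v k - v 1%N.
Proof.
elim: k => // -[_ _ _|k IH _ mv]; first by rewrite big_geq// mulr0 subrr.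
rewrite big_nat_recr//= mulrDr; have := mv k.+1 (ltnSn _).
suff : c * \sum_(1 <= l < k.+1) m l <= v k.+1 - v 1%N by lra.
by apply: IH => // l /andP[l0 lk]; apply: mv; rewrite l0 ltnW.
Qed.

Lemma bigO_le r e (K : R) : (forall k, 0 <= r k) ->
  (\forall k \near \oo, 0 <= e k) -> (\forall k \near \oo, r k <= K * e k) ->
  (r : nat -> R^o) =O_\oo (e : nat -> R^o).
Proof.
move=> r0 e0 rK; apply/eqOP; near=> K' => /=; near=> k.
rewrite ger0_norm// ger0_norm; last by near: k.
apply: (@le_trans _ _ (K * e k)); first by near: k.
apply: ler_wpM2r; first by near: k.
by near: K'; apply: nbhs_pinfty_ge; exact: num_real.
Unshelve. all: by end_near. Qed.

Lemma le_of_mul_nincr r e : (forall k, 0 < e k) ->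
  (\forall k \near \oo, r k.+1 * e k.+1 <= r k * e k) ->
  exists K, \forall k \near \oo, r k <= K * (e k)^-1.
Proof.
move=> e0 [N _ re]; exists (r N * e N); exists N => // k /= Nk.
rewrite ler_pdivlMr//; elim: k Nk => [|k IH]; first by rewrite leqn0 => /eqP->.
rewrite leq_eqVlt => /predU1P[<-//|]; rewrite ltnS => Nk.
exact: le_trans (re k Nk) (IH Nk).
Qed.

(** A positive limit inferior is the limit of the infima of the tails, even if
    the sequence is unbounded, since [limn] is [0] without convergence. *)
Lemma limn_inf_lt (u : nat -> R^o) (c : R) : (forall k, 0 <= u k) ->
  0 <= c < limn_inf u -> \forall k \near \oo, c <= u k.
Proof.
move=> u0 /andP[c0 cu]; have [cv|ncv] := pselect (cvgn (infs u)); last first.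
  by move: cu; rewrite /limn_inf (dvgP ncv) ltNge c0.
near=> k; apply: (@le_trans _ _ (infs u k)).
  by near: k; apply: cvgr_ge cu; exact: cv.
apply: ge_inf; last by exists k => /=.
by exists 0 => _ [l _ <-].
Unshelve. all: by end_near. Qed.

End SequenceBounds.

Section GapSequence.
Context {R : realType}.
Variables (r m : nat -> R) (p : R).
Hypothesis r_ge0 : forall k, 0 <= r k.
Hypothesis r_nincr : forall k, (0 < k)%N -> r k.+1 <= r k.
Hypothesis m_ge0 : forall k, 0 <= m k.
Hypothesis p_ge0 : 0 <= p.
Hypothesis r_step : forall k, (0 < k)%N -> 0 < r k.+1 ->
  m k * r k.+1 `^ p <= r k - r k.+1.

Notation S k := (\sum_(1 <= l < k) m l).

Lemma gap_le j k : (0 < j)%N -> (j <= k)%N -> r k <= r j.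
Proof.
move=> j0; elim: k => [|k IH]; first by rewrite leqn0 => /eqP->.
rewrite leq_eqVlt => /predU1P[<-//|]; rewrite ltnS => jk.
exact: le_trans (r_nincr (leq_trans j0 jk)) (IH jk).
Qed.

Lemma not_uniform_decrease (c : R) : (forall A, exists k, A < S k) -> 0 < c ->
  ~ (forall k, (0 < k)%N -> c * m k <= r k - r k.+1).
Proof.
move=> Soo c0 mr; have [k] := Soo (r 1%N / c).
rewrite ltr_pdivrMr// mulrC ltNge => /negP; apply.
case: k => [|k]; first by rewrite big_geq ?mulr0.
suff : c * S k.+1 <= - r k.+1 - - r 1%N by have := r_ge0 k.+1; lra.
apply: (sum_le_telescope (v := fun k => - r k)) => // l /andP[l0 _].
by have := mr l l0; lra.
Qed.

(** As long as the gap stays above [rho], each step decreases it by at least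
    [rho ^ p] times the step length, which a divergent sum forbids. *)
Lemma gap_lt (rho : R) : (forall A, exists k, A < S k) -> 0 < rho ->
  exists2 k, (0 < k)%N & r k < rho.
Proof.
move=> Soo rho0; apply: contrapT => nolt.
have rhor k : (0 < k)%N -> rho <= r k.
  by move=> k0; rewrite leNgt; apply/negP => ?; apply: nolt; exists k.
apply: (not_uniform_decrease Soo (powR_gt0 p rho0)) => k k0.
apply: le_trans (r_step k0 (lt_le_trans rho0 (rhor k.+1 isT))).
rewrite mulrC ler_wpM2l// ge0_ler_powR// ?nnegrE ?(ltW rho0)//; exact: rhor.
Qed.

Lemma gap_cvg0 : (forall A, exists k, A < S k) -> r k @[k --> \oo] --> (0 : R).
Proof.
move=> Soo; apply/cvgrPdist_lt => e e0.
have [N N0 rN] := gap_lt Soo e0; exists N => // k /= Nk.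
by rewrite sub0r normrN ger0_norm// (le_lt_trans (gap_le N0 Nk)).
Qed.

Lemma gap_eventually0 : (forall A, exists k, A < S k) -> p = 0 ->
  \forall k \near \oo, r k = 0.
Proof.
move=> Soo p0; apply: contrapT => nev.
have rgt0 k : (0 < k)%N -> 0 < r k.
  move=> k0; rewrite lt_neqAle r_ge0 andbT eq_sym; apply/negP => /eqP rk0.
  apply: nev; exists k => // l /= kl; apply/eqP.
  by rewrite eq_le r_ge0 -rk0 gap_le.
apply: (not_uniform_decrease Soo ltr01) => k k0.
by have := r_step k0 (rgt0 k.+1 isT); rewrite p0 powRr0; lra.
Qed.

(** A gap of at most [1] is dominated by its power of exponent [p <= 1], so the
    recursion for such [p] is at least as strong as the linear one. *)
Lemma gap_linear_step k : p <= 1 -> (0 < k)%N -> r k.+1 <= 1 ->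
  r k.+1 * (1 + m k) <= r k.
Proof.
move=> p1 k0 rk1; have := r_ge0 k.+1; rewrite le_eqVlt => /predU1P[<-|rk0].
  by rewrite mul0r.
have := r_step k0 rk0; have : m k * r k.+1 <= m k * r k.+1 `^ p.
  by rewrite ler_wpM2l// ger1_powR ?rk0.
lra.
Qed.

(** The potential [r ^ (- q)] with [q = p - 1] grows by at least a constant
    times [m k] at each step: [r k >= r k.+1 * (1 + u)] with
    [u = m k * r k.+1 ^ q] bounded, and [(1 + u) ^ q >= 1 + q u / (1 + u)]. *)
Lemma gap_potential (M q : R) : (forall k, m k <= M) -> 0 < q -> p = 1 + q ->
  0 < r 1%N ->
  exists2 c : R, 0 < c &
    forall k, (0 < k)%N -> 0 < r k -> c * S k.+1 <= r k `^ (- q).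
Proof.
move=> mM q0 pE r1.
have M0 : 0 <= M by exact: le_trans (m_ge0 0) (mM 0).
set X1 := r 1%N `^ q; have X10 : 0 < X1 by rewrite powR_gt0.
have q_ge0 := ltW q0; have X1_ge0 := ltW X10.
pose D := 1 + (1 + q) * (M * X1).
have D0 : 0 < D by rewrite ltr_pwDl ?mulr_ge0 ?addr_ge0.
pose c1 := q / D; have c10 : 0 < c1 by rewrite divr_gt0.
pose c2 := X1^-1 / (1 + M); have c20 : 0 < c2 by rewrite divr_gt0 ?invr_gt0// ltr_pwDl.
have step l : (0 < l)%N -> 0 < r l.+1 ->
    c1 * m l <= r l.+1 `^ (- q) - r l `^ (- q).
  move=> l0 rl0; have := r_step l0 rl0.
  rewrite pE powRD ?(gt_eqF rl0) ?implybT// powRr1// => stp.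
  rewrite !powRN; set X := r l.+1 `^ q in stp *; set Y := r l `^ q.
  have X0 : 0 < X by rewrite powR_gt0.
  have X_ge0 := ltW X0; have rl_ge0 := ltW rl0.
  have XX1 : X <= X1.
    by rewrite ge0_ler_powR ?nnegrE ?(ltW q0)//; exact: gap_le.
  pose u := m l * X; have u0 : 0 <= u by rewrite mulr_ge0.
  have uU : u <= M * X1 by rewrite ler_pM.
  have u1 : 0 < 1 + u by rewrite ltr_pwDl.
  have u1_ge0 := ltW u1.
  have rr : r l.+1 * (1 + u) <= r l by rewrite /u; lra.
  have XY : X * (1 + q * (u / (1 + u))) <= Y.
    apply: (@le_trans _ _ ((r l.+1 * (1 + u)) `^ q)).
      by rewrite powRM// -/X ler_pM2l// powR_1D_ge.
    by rewrite ge0_ler_powR ?nnegrE// mulr_ge0.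
  have Z0 : 0 < 1 + (1 + q) * u by rewrite ltr_pwDl ?mulr_ge0 ?addr_ge0.
  have XZ0 : 0 < X * (1 + q * (u / (1 + u))).
    by rewrite mulr_gt0// ltr_pwDl// mulr_ge0// divr_ge0.
  have Yinv : Y^-1 <= X^-1 * ((1 + u) / (1 + (1 + q) * u)).
    have -> : X^-1 * ((1 + u) / (1 + (1 + q) * u)) =
        (X * (1 + q * (u / (1 + u))))^-1.
      field; rewrite !gt_eqF//=; lra.
    by rewrite lef_pV2 ?posrE// (lt_le_trans _ XY).
  have : c1 * m l <= X^-1 * (q * u / (1 + (1 + q) * u)).
    have -> : X^-1 * (q * u / (1 + (1 + q) * u)) = q / (1 + (1 + q) * u) * m l.
      by rewrite /u; field; rewrite !gt_eqF.
    rewrite ler_wpM2r// /c1 ler_pM2l// lef_pV2 ?posrE// /D lerD2l ler_wpM2l//.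
    by rewrite addr_ge0.
  have : X^-1 = X^-1 * ((1 + u) / (1 + (1 + q) * u)) +
      X^-1 * (q * u / (1 + (1 + q) * u)).
    by field; rewrite !gt_eqF.
  lra.
(* [c2] pays for the last term [m k] out of the initial value of the potential,
   which shifts the sum from [S k] to [S k.+1]. *)
exists (Num.min c1 c2); first by rewrite lt_min c10.
move=> k k0 rk; rewrite big_nat_recr//= mulrDr.
have tel : c1 * S k <= r k `^ (- q) - r 1%N `^ (- q).
  apply: (sum_le_telescope (v := fun k => r k `^ (- q))) => // l /andP[l0 lk].
  by apply: step => //; apply: (lt_le_trans rk); exact: gap_le.
have S0 : 0 <= S k by apply: sumr_ge0.
have h1 : Num.min c1 c2 * S k <= c1 * S k by rewrite ler_wpM2r// ge_min lexx.
have h2 : Num.min c1 c2 * m k <= c2 * M.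
  apply: (@le_trans _ _ (c2 * m k)).
    by rewrite ler_wpM2r// ge_min lexx orbT.
  by rewrite ler_wpM2l// ltW.
have h3 : c2 * M <= X1^-1.
  rewrite /c2 -mulrA ger_pMr ?invr_gt0// mulrC ler_pdivrMr; lra.
move: tel; rewrite [r 1%N `^ _]powRN -/X1; lra.
Qed.

End GapSequence.

(** * Rates in terms of the growth of the step sums *)

(** The steps [a k] are truncated at [2 * C ^+ 2], so that [m k <= 2]: bounded
    steps make the loss of the last term of a sum a bounded factor. The growth of
    the truncated sums is measured against a reference sequence [e], which is
    [k], [k ^ (1 - d)] or [ln k] in the three regimes. *)
Section TruncatedSteps.
Context {R : realType}.
Variables (r a e : nat -> R) (theta C c0 : R).
Hypothesis theta_range : 0 < theta <= 1.
Hypothesis C_gt0 : 0 < C.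
Hypothesis r_ge0 : forall k, 0 <= r k.
Hypothesis r_nincr : forall k, (0 < k)%N -> r k.+1 <= r k.
Hypothesis a_ge0 : forall k, 0 <= a k.
Hypothesis r_step : forall k, (0 < k)%N -> 0 < r k.+1 ->
  a k / C ^+ 2 * r k.+1 `^ (2 * (1 - theta)) <= r k - r k.+1.

Notation s k := (\sum_(1 <= l < k.+1) Num.min (a l) (2 * C ^+ 2)).

Hypothesis c0_gt0 : 0 < c0.
Hypothesis e_ge0 : forall k, 0 <= e k.
Hypothesis e_large : forall A, \forall k \near \oo, A <= e k.
Hypothesis s_ge : \forall k \near \oo, c0 * e k <= s k.

Let m k := Num.min (a k) (2 * C ^+ 2) / C ^+ 2.
Let S k := \sum_(1 <= l < k) m l.

Let C2_gt0 : 0 < C ^+ 2. Proof. exact: exprn_gt0. Qed.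
Let p_ge0 : 0 <= 2 * (1 - theta).
Proof. by case/andP: theta_range => *; lra. Qed.

Let m_ge0 k : 0 <= m k.
Proof. by rewrite divr_ge0 ?(ltW C2_gt0)// le_min a_ge0 mulr_ge0 ?(ltW C2_gt0). Qed.

Let m_le2 k : m k <= 2.
Proof. by rewrite ler_pdivrMr// ge_min lexx orbT. Qed.

Let m_step k : (0 < k)%N -> 0 < r k.+1 ->
  m k * r k.+1 `^ (2 * (1 - theta)) <= r k - r k.+1.
Proof.
move=> k0 rk; apply: le_trans (r_step k0 rk).
by rewrite ler_wpM2r ?powR_ge0// ler_wpM2r ?invr_ge0 ?(ltW C2_gt0)// ge_min lexx.
Qed.

Let sumE k : S k.+1 = s k / C ^+ 2.
Proof. by rewrite /S -mulr_suml. Qed.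

Let S_large (A : R) : exists k, A < S k.
Proof.
near \oo => k; exists k.+1; rewrite sumE ltr_pdivlMr//.
apply: (@lt_le_trans _ _ (c0 * e k)); last by near: k.
apply: (@lt_le_trans _ _ (c0 * ((A * C ^+ 2 + 1) / c0))).
  by rewrite [ltRHS]mulrC divfK ?gt_eqF// ltrDl.
rewrite ler_pM2l//; near: k; exact: e_large.
Unshelve. all: by end_near. Qed.

Lemma rate_cvg0 : r k @[k --> \oo] --> (0 : R).
Proof. exact: gap_cvg0 r_ge0 r_nincr m_ge0 p_ge0 m_step S_large. Qed.

Lemma rate_finite : theta = 1 -> \forall k \near \oo, r k = 0.
Proof.
move=> th; apply: (gap_eventually0 r_ge0 r_nincr m_step S_large).
by rewrite th subrr mulr0.
Qed.

Lemma rate_power : theta < 2^-1 ->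
  exists K, \forall k \near \oo, r k <= K * e k `^ (- (1 - 2 * theta)^-1).
Proof.
move=> th; set q := 1 - 2 * theta; have q0 : 0 < q by rewrite /q; lra.
have pE : 2 * (1 - theta) = 1 + q by rewrite /q; lra.
have [r1|r1] := ltP 0 (r 1%N); last first.
  exists 0; exists 1%N => // k /= k1; rewrite mul0r (le_trans _ r1)//.
  exact: gap_le r_nincr _ _ _ k1.
have [c c_gt0 rc] := gap_potential r_ge0 r_nincr m_ge0 m_step m_le2 q0 pE r1.
pose c' := c * c0 / C ^+ 2; have c'0 : 0 < c' by rewrite divr_gt0// mulr_gt0.
exists (c' `^ (- q^-1)); near=> k.
have k0 : (0 < k)%N by near: k; exists 1%N.
have ek : 0 < e k by apply: (@lt_le_trans _ _ 1) => //; near: k; exact: e_large.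
have := r_ge0 k; rewrite le_eqVlt => /predU1P[<-|rk].
  by rewrite mulr_ge0 ?powR_ge0.
rewrite -powRM ?(ltW c'0) ?(ltW ek)//.
have -> : r k = (r k `^ (- q)) `^ (- q^-1).
  by rewrite -powRrM mulrNN divff ?gt_eqF// powRr1 ?(ltW rk).
have ce0 := mulr_gt0 c'0 ek; have ce := ltW ce0.
rewrite !(powRN _ q^-1) lef_pV2 ?posrE ?powR_gt0//.
rewrite ge0_ler_powR ?nnegrE ?invr_ge0 ?powR_ge0 ?(ltW q0)//.
apply: (le_trans _ (rc k k0 rk)).
have -> : c' * e k = c * (c0 * e k / C ^+ 2).
  by rewrite /c'; field; rewrite gt_eqF.
have iC2 : 0 < C ^- 2 by rewrite invr_gt0.
rewrite -/(S k.+1) sumE ler_pM2l// ler_pM2r//.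
by near: k.
Unshelve. all: by end_near. Qed.

(** The steps being small, [1 + m k >= expR (3 / 4 * m k)], so the gap is
    bounded by [expR (- 3 / 4 * s k / C ^+ 2)] up to a factor; the margin between
    [3 / 4] and [1 / 2] pays for [s k / e k] being only eventually close to its
    limit inferior. *)
Lemma rate_exp : 2^-1 <= theta -> (\forall k \near \oo, a k <= C ^+ 2 / 3) ->
  exists K, \forall k \near \oo, r k <=
    K * expR (- (limn_inf (fun k => s k / e k : R^o) / (2 * C ^+ 2) * e k)).
Proof.
move=> th a_small; have p1 : 2 * (1 - theta) <= 1 by lra.
have r_le1 : \forall k \near \oo, r k <= 1.
  by apply: (cvgr_le 0 rate_cvg0); exact: ltr01.
set l := limn_inf _; have [l0|l0] := leP l 0.
  exists 1; near=> k; rewrite mul1r (@le_trans _ _ 1)//; first by near: k.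
  rewrite -expR0 ler_expR oppr_ge0 mulr_le0_ge0//.
  by rewrite mulr_le0_ge0// invr_ge0 mulr_ge0// ltW.
have [||K rK] := @le_of_mul_nincr _ r (fun k => expR (3 / 4 * S k)).
- by move=> k; exact: expR_gt0.
- near=> k.
  have k0 : (0 < k)%N by near: k; exists 1%N.
  have -> : S k.+1 = m k + S k by rewrite /S big_nat_recr//= addrC.
  rewrite mulrDr expRD mulrA ler_pM2r ?expR_gt0//.
  apply: (@le_trans _ _ (r k.+1 * (1 + m k))).
    rewrite ler_wpM2l// expR_le_1D// m_ge0/= /m ler_pdivrMr// ge_min.
    by rewrite mulrC; apply/orP; left; near: k.
  apply: (gap_linear_step r_ge0 m_ge0 m_step p1 k0).
  by apply: (le_trans (r_nincr k0)); near: k.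
exists (`|K| * expR (3 / 2)); near=> k.
have k0 : (0 < k)%N by near: k; exists 1%N.
have ek : 0 < e k by apply: (@lt_le_trans _ _ 1) => //; near: k; exact: e_large.
have rk : r k <= K * (expR (3 / 4 * S k))^-1 by near: k.
apply: (le_trans rk); rewrite -expRN -[leRHS]mulrA -expRD.
apply: (@le_trans _ _ (`|K| * expR (- (3 / 4 * S k)))).
  by rewrite ler_wpM2r ?expR_ge0// ler_norm.
rewrite ler_wpM2l// ler_expR.
have skl : 2 / 3 * l <= s k / e k.
  near: k; apply: limn_inf_lt => [k|]; last by rewrite -/l; lra.
  by rewrite divr_ge0// sumr_ge0// => j _; rewrite le_min a_ge0 mulr_ge0 ?(ltW C2_gt0).
have : S k.+1 <= S k + 2 by rewrite {1}/S big_nat_recr//= lerD2l.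
rewrite sumE; have : 2 / 3 * l * e k / C ^+ 2 <= s k / C ^+ 2.
  by rewrite ler_pM2r ?invr_gt0// -ler_pdivlMr.
have -> : l / (2 * C ^+ 2) * e k = 3 / 4 * (2 / 3 * l * e k / C ^+ 2).
  by field; rewrite gt_eqF.
lra.
Unshelve. all: by end_near. Qed.

Lemma rate_geometric (a0 : R) : 2^-1 <= theta -> 0 < a0 ->
  (forall k, (0 < k)%N -> a0 <= a k) ->
  exists K, \forall k \near \oo, r k <= K * (C ^+ 2 / (C ^+ 2 + a0)) ^+ k.
Proof.
move=> th a0_gt0 a0a; have p1 : 2 * (1 - theta) <= 1 by lra.
have r_le1 : \forall k \near \oo, r k <= 1.
  by apply: (cvgr_le 0 rate_cvg0); exact: ltr01.
have b0 : 0 <= a0 / C ^+ 2 by rewrite divr_ge0 ?(ltW C2_gt0) ?(ltW a0_gt0).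
have b_step k : (0 < k)%N -> 0 < r k.+1 ->
    a0 / C ^+ 2 * r k.+1 `^ (2 * (1 - theta)) <= r k - r k.+1.
  move=> k0 rk; apply: le_trans (r_step k0 rk).
  by rewrite ler_wpM2r ?powR_ge0// ler_wpM2r ?invr_ge0 ?(ltW C2_gt0)// a0a.
have -> : C ^+ 2 / (C ^+ 2 + a0) = (1 + a0 / C ^+ 2)^-1.
  by field; rewrite !gt_eqF// addr_gt0.
have [||K rK] := @le_of_mul_nincr _ r (fun k => (1 + a0 / C ^+ 2) ^+ k).
- by move=> k; rewrite exprn_gt0// ltr_pwDl.
- near=> k; have k0 : (0 < k)%N by near: k; exists 1%N.
  rewrite exprS mulrA ler_pM2r ?exprn_gt0 ?ltr_pwDl//.
  apply: (gap_linear_step (m := fun=> a0 / C ^+ 2) r_ge0 (fun=> b0) b_step p1 k0).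
  by apply: (le_trans (r_nincr k0)); near: k.
by exists K; apply: filterS rK => k; rewrite exprVn.
Unshelve. all: by end_near. Qed.

End TruncatedSteps.

Section DivergentSums.
Context {R : realType}.

Lemma natr_powR_large (d A : R) : 0 < d -> \forall k \near \oo, A <= k%:R `^ d.
Proof.
move=> d0; near=> k.
apply: (@le_trans _ _ `|A|); first exact: ler_norm.
have -> : `|A| = (`|A| `^ d^-1) `^ d.
  by rewrite -powRrM mulVf ?gt_eqF// powRr1.
rewrite ge0_ler_powR ?nnegrE ?powR_ge0 ?(ltW d0)//.
by near: k; exact: nbhs_infty_ger.
Unshelve. all: by end_near. Qed.

Lemma ln_natr_large (A : R) : \forall k \near \oo, A <= ln (k%:R : R).
Proof.
near=> k; rewrite -[A]expRK ler_ln ?posrE ?expR_gt0//.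
  by near: k; exact: nbhs_infty_ger.
by rewrite ltr0n; near: k; exists 1%N.
Unshelve. all: by end_near. Qed.

Lemma sum_powRN_ge (d : R) k : 0 <= d < 1 ->
  k%:R `^ (1 - d) <= \sum_(1 <= l < k.+1) (l%:R : R) `^ (- d).
Proof.
move=> /andP[d0 d1]; case: k => [|k].
  by rewrite big_geq// powR0// gt_eqF// subr_gt0.
have k0 : 0 < k.+1%:R :> R by rewrite ltr0n.
rewrite powRD ?(gt_eqF k0) ?implybT// powRr1 ?(ltW k0)//.
have -> : k.+1%:R * k.+1%:R `^ (- d) = \sum_(1 <= l < k.+2) (k.+1%:R : R) `^ (- d).
  by rewrite sumr_const_nat subn1/= mulr_natl.
apply: ler_sum_nat => l /andP[l0 lk]; rewrite !powRN lef_pV2 ?posrE ?powR_gt0 ?ltr0n//.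
by rewrite ge0_ler_powR ?nnegrE ?ler0n// ler_nat.
Qed.

(** Telescoping [ln (l + 1) - ln l <= 1 / l]. *)
Lemma sum_inv_ge k : ln (k%:R : R) <= \sum_(1 <= l < k.+1) (l%:R : R)^-1.
Proof.
case: k => [|k]; first by rewrite big_geq// ln0.
have : -1 * \sum_(1 <= l < k.+2) (l%:R : R)^-1 <= - ln (k.+2%:R : R) - - ln (1%N%:R : R).
  apply: (sum_le_telescope (v := fun k => - ln (k%:R : R))) => // l /andP[l0 _].
  have l0' : 0 < l%:R :> R by rewrite ltr0n.
  have : ln (1 + (l%:R : R)^-1) <= l%:R^-1.
    by apply: le_ln1Dx; rewrite (@lt_trans _ _ 0)// ?ltrN10// invr_gt0.
  have -> : 1 + (l%:R : R)^-1 = l.+1%:R / l%:R.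
    by rewrite -natr1; field; rewrite gt_eqF.
  by rewrite ln_div ?posrE ?ltr0n//; lra.
rewrite ln1; have : ln (k.+1%:R : R) <= ln (k.+2%:R : R).
  by rewrite ler_ln ?posrE ?ltr0n// ler_nat.
lra.
Qed.

(** Finitely many terms are absorbed by halving the constant, because [e]
    tends to infinity. *)
Lemma sum_ge_eventually (m t e : nat -> R) (c : R) : 0 < c ->
  (forall k, e k <= \sum_(1 <= l < k.+1) t l) ->
  (forall A, \forall k \near \oo, A <= e k) ->
  (\forall k \near \oo, c * t k <= m k) ->
  \forall k \near \oo, c / 2 * e k <= \sum_(1 <= l < k.+1) m l.
Proof.
move=> c0 et e_large [N _ tm].
pose D k := \sum_(1 <= l < k.+1) (m l - c * t l).
have DN k : (N <= k)%N -> D N <= D k.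
  elim: k => [|k IH]; first by rewrite leqn0 => /eqP->.
  rewrite leq_eqVlt => /predU1P[<-//|]; rewrite ltnS => Nk.
  apply: (le_trans (IH Nk)); rewrite /D (big_nat_recr k.+1)//= lerDl subr_ge0.
  exact: tm (leqW Nk).
near=> k.
have Nk : (N <= k)%N by near: k; exists N.
have := DN k Nk; rewrite {2}/D sumrB -mulr_sumr.
have : - D N / (c / 2) <= e k by near: k; exact: e_large.
rewrite ler_pdivrMr ?divr_gt0//.
have : c * e k <= c * \sum_(1 <= l < k.+1) t l by rewrite ler_pM2l.
lra.
Unshelve. all: by end_near. Qed.

End DivergentSums.

Section DecreaseRates.
Context {R : realType}.
Variables (L C gamma d : R) (alpha : nat -> R).
Hypothesis L_gt0 : 0 < L.
Hypothesis C_gt0 : 0 < C.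
Hypothesis gammaE : gamma = L^-1.
Hypothesis d_gt0 : 0 < d.
Hypothesis alpha_rate : tends_to_1_at_rate alpha d.

Let gamma_gt0 : 0 < gamma. Proof. by rewrite gammaE invr_gt0. Qed.

Lemma decreaseE k : decrease gamma L alpha k = (1 - alpha (2 * k)%N) * (gamma / 8).
Proof. by rewrite /decrease gammaE mulVf ?gt_eqF//; field; rewrite gt_eqF. Qed.

Lemma decrease_ge_rate :
  exists2 c : R, 0 < c &
    \forall k \near \oo, c * k%:R `^ (- d) <=
      Num.min (decrease gamma L alpha k) (2 * C ^+ 2).
Proof.
have [c1 [c2 [/andP[c1_gt0 _] [N _ rate]]]] := alpha_rate.
pose c := c1 * (gamma / 8) / 2 `^ d.
have c_gt0 : 0 < c by rewrite !(mulr_gt0, divr_gt0, invr_gt0) ?powR_gt0.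
have C2_gt0 : 0 < 2 * C ^+ 2 by rewrite mulr_gt0 ?exprn_gt0.
exists (Num.min c (2 * C ^+ 2)); first by rewrite lt_min c_gt0.
near=> k.
have k0 : (0 < k)%N by near: k; exists 1%N.
have kd_gt0 : 0 < k%:R `^ d :> R by rewrite powR_gt0// ltr0n.
rewrite powRN le_min; apply/andP; split; last first.
  rewrite ler_pdivrMr// (@le_trans _ _ (2 * C ^+ 2))// ?ge_min ?lexx ?orbT//.
  by rewrite ler_peMr ?(ltW C2_gt0)//; near: k; exact: natr_powR_large.
apply: (@le_trans _ _ (c / k%:R `^ d)).
  by rewrite ler_pM2r ?invr_gt0// ge_min lexx.
rewrite decreaseE /c -mulrA -invfM -powRM ?ler0n// -natrM mulrAC.
rewrite ler_pM2r ?divr_gt0//.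
have /rate/andP[] // : (N <= 2 * k)%N.
by near: k; exists N => // k /= Nk; rewrite (leq_trans Nk)// leq_pmull.
Unshelve. all: by end_near. Qed.

Lemma decrease_small (eps : R) : 0 < eps ->
  \forall k \near \oo, decrease gamma L alpha k <= eps.
Proof.
have [c1 [c2 [/andP[c1_gt0 c12] [N _ rate]]]] := alpha_rate.
move=> eps0; near=> k.
have k0 : (0 < k)%N by near: k; exists 1%N.
have c2_gt0 := lt_le_trans c1_gt0 c12.
have kd_gt0 : 0 < (2 * k)%:R `^ d :> R by rewrite powR_gt0// ltr0n muln_gt0.
have Nk : (N <= 2 * k)%N.
  by near: k; exists N => // k /= Nk; rewrite (leq_trans Nk)// leq_pmull.
have /andP[_ ub] := rate _ Nk.
rewrite decreaseE -ler_pdivlMr ?divr_gt0//; apply: (le_trans ub).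
rewrite ler_pdivrMr// mulrC -ler_pdivrMr ?divr_gt0//.
apply: (@le_trans _ _ (k%:R `^ d)).
  by near: k; exact: natr_powR_large.
by rewrite ge0_ler_powR ?nnegrE ?ler0n ?(ltW d_gt0)// ler_nat leq_pmull.
Unshelve. all: by end_near. Qed.

End DecreaseRates.

(** * Convergence rates of alternated inertia *)

Theorem corollary3p5 (R : realType) (n : nat) (f : 'rV[R]_n -> R)
    (g : 'rV[R]_n -> \bar R) (L theta C gamma : R) (alpha : nat -> R)
    (x y : nat -> 'rV[R]_n)
    (f_convex : @convex_function R 'rV[R]_n setT f)
    (f_diff : forall z, differentiable f z)
    (L_gt0 : 0 < L) (f_smooth : lipschitz_gradient L f)
    (g_convex : econvex g) (g_proper : eproper g)
    (g_lsc : lower_semicontinuous g)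
    (F_argmin : argmin (objective f g) !=set0)
    (theta_range : 0 < theta <= 1) (C_gt0 : 0 < C)
    (F_KL : KL (objective f g) theta C)
    (gamma_gt0 : 0 < gamma) (alpha_range : forall k, 0 <= alpha k <= 1)
    (algo : alternated_inertia gamma f g alpha x y) :
  let F := objective f g in
  let a_ := decrease gamma L alpha in
  let s_ := decrease_sum gamma L C alpha in
  let converges := F (y (2 * k)%N) @[k --> \oo] --> einf F in
  let finite_convergence := \forall k \near \oo, F (y (2 * k)%N) = einf F in
  ((gamma < L^-1 \/
    (gamma = L^-1 /\ exists2 abar : R, abar < 1 & forall k, alpha k <= abar)) ->
   [/\ converges,
       theta < 2^-1 -> even_gap F y =O_\oo
         (fun k => k%:R `^ (- (1 + 2 * theta / (1 - 2 * theta))) : R^o),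
       exists2 a : R, 0 < a & forall k, (1 <= k)%N -> a <= a_ k,
       2^-1 <= theta < 1 ->
         forall a : R, 0 < a -> (forall k, (1 <= k)%N -> a <= a_ k) ->
         even_gap F y =O_\oo (fun k => (C ^+ 2 / (C ^+ 2 + a)) ^+ k : R^o)
     & theta = 1 -> finite_convergence]) /\
  (forall d : R, 0 < d < 1 -> gamma = L^-1 -> tends_to_1_at_rate alpha d ->
   let C' := limn_inf (fun k => s_ k / k%:R `^ (1 - d)) in
   [/\ converges,
       theta < 2^-1 -> even_gap F y =O_\oo
         (fun k => k%:R `^ (- (1 + (2 * theta - d) / (1 - 2 * theta))) : R^o),
       2^-1 <= theta < 1 -> even_gap F y =O_\oo
         (fun k => expR (- (C' / (2 * C ^+ 2) * k%:R `^ (1 - d))) : R^o)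
     & theta = 1 -> finite_convergence]) /\
  (gamma = L^-1 -> tends_to_1_at_rate alpha 1 ->
   let C'' := limn_inf (fun k => s_ k / ln k%:R) in
   [/\ converges,
       theta < 2^-1 -> even_gap F y =O_\oo
         (fun k => ln k%:R `^ (- (1 - 2 * theta)^-1) : R^o),
       2^-1 <= theta < 1 -> even_gap F y =O_\oo
         (fun k => k%:R `^ (- (C'' / (2 * C ^+ 2))) : R^o)
     & theta = 1 -> finite_convergence]).

Proof.
move=> F a_ s_ converges finite_convergence.
pose r : nat -> R := even_gap F y.
have r_ge0 k : 0 <= r k by exact: even_gap_ge0.
have Linv : L^-1 * L = 1 by rewrite mulVf ?gt_eqF.
have C2_gt0 : 0 < C ^+ 2 by rewrite exprn_gt0.
have r_nincr (gL : gamma * L <= 1) k : (0 < k)%N -> r k.+1 <= r k.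
  exact: (even_gap_nincr f_convex f_diff f_smooth g_convex g_proper g_lsc F_argmin
    gamma_gt0 alpha_range gL algo).
have r_step (gL : gamma * L <= 1) k : (0 < k)%N -> 0 < r k.+1 ->
    a_ k / C ^+ 2 * r k.+1 `^ (2 * (1 - theta)) <= r k - r k.+1.
  exact: (even_gap_KL f_convex f_diff f_smooth g_convex g_proper g_lsc F_argmin
    L_gt0 gamma_gt0 C_gt0 F_KL alpha_range gL algo).
have a_ge0 (gL : gamma * L <= 1) k : 0 <= a_ k by exact: decrease_ge0.
have cvg (gL : gamma * L <= 1) e c0 (c0_gt0 : 0 < c0)
    (e_large : forall A, \forall k \near \oo, A <= e k)
    (s_ge : \forall k \near \oo, c0 * e k <= s_ k) : converges.
  apply: (objective_cvg f_diff f_smooth g_convex g_proper g_lsc F_argmin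
    gamma_gt0 algo).
  exact: (rate_cvg0 theta_range C_gt0 r_ge0 (r_nincr gL) (a_ge0 gL) (r_step gL)
    c0_gt0 e_large s_ge).
have finite (gL : gamma * L <= 1) e c0 (c0_gt0 : 0 < c0)
    (e_large : forall A, \forall k \near \oo, A <= e k)
    (s_ge : \forall k \near \oo, c0 * e k <= s_ k) :
    theta = 1 -> finite_convergence.
  move=> th; apply: (objective_finite f_diff f_smooth g_convex g_proper g_lsc
    F_argmin gamma_gt0 algo).
  exact: (rate_finite C_gt0 r_ge0 (r_nincr gL) (r_step gL) c0_gt0 e_large s_ge).
have power (gL : gamma * L <= 1) e c0 :=
  @rate_power R r a_ e theta C c0 C_gt0 r_ge0 (r_nincr gL) (a_ge0 gL) (r_step gL).
have exponential (gL : gamma * L <= 1) e c0 :=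
  @rate_exp R r a_ e theta C c0 theta_range C_gt0 r_ge0 (r_nincr gL) (a_ge0 gL)
    (r_step gL).
have bigO e : (forall k, 0 <= e k) ->
    (exists K, \forall k \near \oo, r k <= K * e k) ->
    even_gap F y =O_\oo (e : nat -> R^o).
  by move=> e0 [K]; apply: bigO_le => //; exact: nearW.
split; [|split].
- move=> regime.
  have gL : gamma * L <= 1.
    case: regime => [/ltW gl|[-> _]]; last by rewrite Linv.
    by rewrite -ler_pdivlMr// mul1r.
  have [a a_gt0 a_le] : exists2 a, 0 < a & forall k, (0 < k)%N -> a <= a_ k.
    (* [b] is [1 - gamma * L] for a short step and [1 - abar] for the full one. *)
    have [b b_gt0 ble] : exists2 b, 0 < b & forall k, b <= 2 - alpha k - gamma * L.
      case: regime => [gl|[-> [abar abar1 ale]]].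
        have : gamma * L < 1 by rewrite -ltr_pdivlMr// mul1r.
        exists (1 - gamma * L) => [|k]; first lra.
        by have /andP[_] := alpha_range k; lra.
      by exists (1 - abar) => [|k]; [lra | rewrite Linv; have := ale k; lra].
    have D_gt0 : 0 < 2 * (1 + gamma * L) ^+ 2.
      by rewrite mulr_gt0// exprn_gt0// ltr_pwDl// mulr_ge0 
        ?(ltW gamma_gt0) ?(ltW L_gt0).
    exists (b * gamma / (2 * (1 + gamma * L) ^+ 2)); 
      first by rewrite divr_gt0// mulr_gt0.
    by move=> k _; rewrite ler_pM2r ?invr_gt0// ler_pM2r.
  pose c0 := Num.min a (2 * C ^+ 2).
  have c0_gt0 : 0 < c0 by rewrite lt_min a_gt0 mulr_gt0.
  have k_large (A : R) : \forall k \near \oo, A <= k%:R by exact: nbhs_infty_ger.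
  have s_ge : \forall k \near \oo, c0 * k%:R <= s_ k.
    apply: nearW => k; rewrite mulr_natr.
    have -> : c0 *+ k = \sum_(1 <= l < k.+1) c0 by rewrite sumr_const_nat subn1.
    apply: ler_sum_nat => l /andP[l0 _].
    by rewrite le_min !ge_min a_le// lexx orbT.
  split.
  + exact: cvg gL _ _ c0_gt0 k_large s_ge.
  + move=> th; apply: bigO => [k|]; first exact: powR_ge0.
    have -> : - (1 + 2 * theta / (1 - 2 * theta)) = - (1 - 2 * theta)^-1.
      by field; rewrite gt_eqF//; lra.
    exact: (power gL _ _ c0_gt0 k_large s_ge th).
  + by exists a.
  + move=> /andP[th _] b b_gt0 b_le; apply: bigO => [k|].
      by rewrite exprn_ge0// divr_ge0 ?addr_ge0 ?(ltW C2_gt0) ?(ltW b_gt0).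
    exact: (rate_geometric theta_range C_gt0 r_ge0 (r_nincr gL) (a_ge0 gL)
      (r_step gL) c0_gt0 k_large s_ge th b_gt0 b_le).
  + exact: finite gL _ _ c0_gt0 k_large s_ge.
- move=> d d01 gE rate C'; have /andP[d0 d1] := d01.
  have gL : gamma * L <= 1 by rewrite gE Linv.
  have [c c_gt0 c_le] := decrease_ge_rate L_gt0 C_gt0 gE d0 rate.
  have k_large (A : R) : \forall k \near \oo, A <= k%:R `^ (1 - d).
    by apply: natr_powR_large; rewrite subr_gt0.
  have c0_gt0 : 0 < c / 2 by rewrite divr_gt0.
  have sum_ge k : (k%:R : R) `^ (1 - d) <= \sum_(1 <= l < k.+1) (l%:R : R) `^ (- d).
    by apply: sum_powRN_ge; rewrite (ltW d0).
  have s_ge := sum_ge_eventually c_gt0 sum_ge k_large c_le.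
  split.
  + exact: cvg gL _ _ c0_gt0 k_large s_ge.
  + move=> th; apply: bigO => [k|]; first exact: powR_ge0.
    have -> : - (1 + (2 * theta - d) / (1 - 2 * theta)) =
        (1 - d) * - (1 - 2 * theta)^-1.
      by field; rewrite gt_eqF//; lra.
    have [K rK] := power gL _ _ c0_gt0 k_large s_ge th.
    by exists K; apply: filterS rK => k; rewrite powRrM.
  + move=> /andP[th _]; apply: bigO => [k|]; first exact: expR_ge0.
    apply: (exponential gL _ _ c0_gt0 _ k_large s_ge th).
      by move=> k; exact: powR_ge0.
    by apply: (decrease_small L_gt0 gE d0 rate); rewrite divr_gt0.
  + exact: finite gL _ _ c0_gt0 k_large s_ge.
- move=> gE rate C''.
  have gL : gamma * L <= 1 by rewrite gE Linv.
  have [c c_gt0 rate_le] := decrease_ge_rate L_gt0 C_gt0 gE ltr01 rate.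
  have c_le : \forall k \near \oo,
      c * (k%:R : R)^-1 <= Num.min (a_ k) (2 * C ^+ 2).
    by apply: filterS rate_le => k; rewrite powR_inv1.
  have k_large := @ln_natr_large R.
  have c0_gt0 : 0 < c / 2 by rewrite divr_gt0.
  have s_ge := sum_ge_eventually c_gt0 (@sum_inv_ge R) k_large c_le.
  have ln_nat_ge0 k : 0 <= ln (k%:R : R).
    by case: k => [|k]; [rewrite ln0 | rewrite ln_ge0// ler1n].
  split.
  + exact: cvg gL _ _ c0_gt0 k_large s_ge.
  + move=> th; apply: bigO => [k|]; first exact: powR_ge0.
    exact: (power gL _ _ c0_gt0 k_large s_ge th).
  + move=> /andP[th _]; apply: bigO => [k|]; first exact: powR_ge0.
    have [||K rK] := exponential gL _ _ c0_gt0 _ k_large s_ge th.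
    * exact: ln_nat_ge0.
    * by apply: (decrease_small L_gt0 gE ltr01 rate); rewrite divr_gt0.
    exists K; near=> k; have k0 : (0 < k)%N by near: k; exists 1%N.
    rewrite [k%:R `^ _]/powR pnatr_eq0 (negPf (lt0n_neq0 k0)) mulNr.
    by near: k.
  + exact: finite gL _ _ c0_gt0 k_large s_ge.
Unshelve. all: by end_near. Qed.
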